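(* The theory $\mathbf{K}\cup\mathbf{KK}$ is not closed generic.
   Context: Fix a nonempty set of symbols called propositional atoms and a symbol $\mathrm{K}$ which is not a propositional atom. Formulas are defined recursively: every propositional atom is a formula; if $\varphi,\psi$ are formulas then so are $\neg\varphi$, $(\varphi\wedge\psi)$, $(\varphi\vee\psi)$, $(\varphi\rightarrow\psi)$; if $\varphi$ is a formula then so is $\mathrm{K}(\varphi)$. A formula is basic if it is a propositional atom or of the form $\mathrm{K}\varphi$. A theory is a set of formulas. A model is a function assigning a truth value to every basic formula; truth $\mathscr M\models\varphi$ of an arbitrary formula is defined from the values of basic formulas by the classical truth tables (formulas $\mathrm{K}\varphi$ are treated like atoms). $\mathscr M\models T$ means $\mathscr M\models\varphi$ for all $\varphi\in T$; $T\models\varphi$ means every model of $T$ satisfies $\varphi$. A theory $T$ is closed if $\varphi\in T$ implies $\mathrm{K}\varphi\in T$. $\mathbf{K}=\{\mathrm{K}(\varphi\rightarrow\psi)\rightarrow(\mathrm{K}\varphi\rightarrow\mathrm{K}\psi)\}$; $\mathbf{KK}=\{\mathrm{K}\varphi\rightarrow\mathrm{K}\mathrm{K}\varphi\}$ (all formulas of these forms). For a theory $T$ and a set $S$ of propositional atoms, $\mathscr M_{T,S}$ is the model with $\mathscr M_{T,S}\models p$ iff $p\in S$ for atoms $p$, and $\mathscr M_{T,S}\models\mathrm{K}\varphi$ iff $T\models\varphi$. A theory $T$ is closed generic if for every set $S$ of propositional atoms and every closed theory $T'\supseteq T$, $\mathscr M_{T',S}\models T$. *)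

(* Defs.v *)
From mathcomp Require Import all_boot.
From mathcomp Require Import boolp classical_sets.

Set Implicit Arguments.
Unset Strict Implicit.
Unset Printing Implicit Defensive.

Local Open Scope classical_set_scope.

Inductive formula (Atom : Type) : Type :=
  | Var of Atom
  | Not of formula Atom
  | And of formula Atom & formula Atom
  | Or of formula Atom & formula Atom
  | Imp of formula Atom & formula Atom
  | K of formula Atom.

Definition basic (Atom : Type) (f : formula Atom) : bool :=
  match f with
  | Var _ | K _ => true
  | _ => false
  end.

Definition theory (Atom : Type) : Type := set (formula Atom).

Definition model (Atom : Type) : Type := {f : formula Atom | basic f} -> bool.

(* No recursive call is made under [K]: a formula [K g] is basic, so its value
   is read off the model, independently of the value of [g]. *)
Fixpoint truth (Atom : Type) (M : model Atom) (f : formula Atom) : bool :=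
  match f with
  | Var p => M (exist _ (Var p) isT)
  | Not g => ~~ truth M g
  | And g h => truth M g && truth M h
  | Or g h => truth M g || truth M h
  | Imp g h => truth M g ==> truth M h
  | K g => M (exist _ (K g) isT)
  end.

Definition models (Atom : Type) (M : model Atom) (T : theory Atom) : Prop :=
  forall f, T f -> truth M f.

Definition entails (Atom : Type) (T : theory Atom) (f : formula Atom) : Prop :=
  forall M : model Atom, models M T -> truth M f.

Definition closed_theory (Atom : Type) (T : theory Atom) : Prop :=
  forall f, T f -> T (K f).

Definition schemaK (Atom : Type) : theory Atom :=
  [set x | exists f g, x = Imp (K (Imp f g)) (Imp (K f) (K g))].

Definition schemaKK (Atom : Type) : theory Atom :=
  [set x | exists f, x = Imp (K f) (K (K f))].

(* The last branch is never reached, since [val b] is basic. *)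
Definition canonical_model (Atom : Type) (T : theory Atom) (S : set Atom) :
    model Atom :=
  fun b => match val b with
           | Var p => `[< S p >]
           | K f => `[< entails T f >]
           | _ => false
           end.

Definition closed_generic (Atom : Type) (T : theory Atom) : Prop :=
  forall (S : set Atom) (T' : theory Atom),
    closed_theory T' -> T `<=` T' -> models (canonical_model T' S) T.

(* Main.v *)
(** A closed theory containing [K] and [KK] need not know every tautology, since
    nothing puts tautologies under [K].  The valuation [erase] reads
    implications classically, ignores [K], and makes every negation false; the
    formulas it accepts contain [K] and [KK] and are closed under modus ponens
    and necessitation, but miss the tautology [~ (p /\ ~ p)].  Let a model [M]
    know exactly these formulas.  Then the accepted formulas which hold in [M]
    form a closed theory that entails the tautology, but, as [M] shows, does
    not entail that the tautology is known.  So the canonical model of this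
    theory falsifies an instance of [KK]. *)

Require Import Defs.
From mathcomp Require Import all_boot.
From mathcomp Require Import boolp classical_sets.

Local Open Scope classical_set_scope.

Fixpoint erase {Atom : Type} (f : formula Atom) : bool :=
  match f with
  | Var _ | Not _ => false
  | And g h => erase g && erase h
  | Or g h => erase g || erase h
  | Imp g h => erase g ==> erase h
  | K g => erase g
  end.

Definition erase_model (Atom : Type) : model Atom :=
  fun b => if val b is K f then erase f else false.

Definition erase_theory (Atom : Type) : theory Atom :=
  [set f | erase f /\ truth (@erase_model Atom) f].

(** Both membership conditions for [K f] compute to [erase f]. *)
Lemma erase_theory_closed (Atom : Type) : closed_theory (@erase_theory Atom).
Proof. by move=> f [ef _]; split. Qed.

(** Under [erase] and in [erase_model] alike, each instance reduces to [b ==> b], where [b] is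
    [erase f ==> erase g] or [erase f]. *)
Lemma erase_theory_K_KK (Atom : Type) :
  @schemaK Atom `|` @schemaKK Atom `<=` @erase_theory Atom.
Proof.
move=> _ [[f [g ->]]|[f ->]]; split; rewrite /= /erase_model /= ?implybb //;
  by case: (erase f); case: (erase g).
Qed.

Lemma entails_noncontradiction (Atom : Type) (T : theory Atom)
    (f : formula Atom) : entails T (Not (And f (Not f))).
Proof. by move=> M _ /=; rewrite andbN. Qed.

(** The countermodel is [erase_model], which satisfies [erase_theory] by the second conjunct of
    membership. *)
Lemma erase_theory_not_entails_K (Atom : Type) (f : formula Atom) :
  ~~ erase f -> ~ entails (@erase_theory Atom) (K f).
Proof. by move=> /negP nef /(_ (@erase_model Atom) (fun _ => @proj2 _ _)). Qed.

Theorem theorem25 (Atom : Type) (Atom_nonempty : inhabited Atom) :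
  ~ closed_generic (@schemaK Atom `|` @schemaKK Atom).
Proof.
case: Atom_nonempty => p cg.
pose f := Not (And (Var p) (Not (Var p))).
have KKf : (@schemaK Atom `|` @schemaKK Atom) (Imp (K f) (K (K f))).
  by right; exists f.
have /implyP := cg set0 _ (@erase_theory_closed Atom) (@erase_theory_K_KK Atom)
  _ KKf.
move=> /(_ (asboolT (entails_noncontradiction _ _ _))) /asboolP.
(* The side condition holds by computation, [f] being a negation. *)
exact: erase_theory_not_entails_K.
Qed.
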